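(* Let $R$ be a ring that is not quasilocal, let $S$ be a multiplicatively closed subset of $R$, let $M$ be a finitely generated multiplication $R$-module and let $N$ be a submodule of $M$ with $(N:_{R}M)\cap S=\emptyset$. Then $N$ is an $S$-$1$-absorbing primary submodule of $M$ if and only if $N$ is an $S$-primary submodule of $M$.
   Context: All rings are commutative with non-zero identity and all modules are unital. A ring is quasilocal if it has exactly one maximal ideal. An $R$-module $M$ is a multiplication module if every submodule of $M$ has the form $IM$ for some ideal $I$ of $R$. For a submodule $N$ of $M$, $(N:_{R}M)=\{r\in R\mid rM\subseteq N\}$. A prime submodule of $M$ is a proper submodule $P$ such that $rm\in P$ ($r\in R$, $m\in M$) implies $r\in(P:_RM)$ or $m\in P$. $M\text{-}rad(N)$ is the intersection of all prime submodules of $M$ containing $N$ (it equals $M$ if there are none). A submodule $N$ of $M$ with $(N:_{R}M)\cap S=\emptyset$ is called $S$-$1$-absorbing primary if there exists a fixed $s\in S$ such that for all non-unit $a,b\in R$ and all $m\in M$, if $abm\in N$, then $sab\in(N:_{R}M)$ or $sm\in M\text{-}rad(N)$. A submodule $N$ of $M$ with $(N:_{R}M)\cap S=\emptyset$ is called $S$-primary if there exists a fixed $s\in S$ such that for all $a\in R$ and $m\in M$, if $am\in N$, then $sa\in\sqrt{(N:_{R}M)}$ or $sm\in N$. *)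

(* Defs.v *)
From HB Require Import structures.
From mathcomp Require Import all_boot all_order all_algebra.
From mathcomp Require Import boolp classical_sets.

Set Implicit Arguments.
Unset Strict Implicit.
Unset Printing Implicit Defensive.

Import GRing.Theory.
Local Open Scope classical_set_scope.
Local Open Scope ring_scope.

(* Subsets are Prop-valued sets; [mem] turns them into the classical boolean
   predicates on which the closure conditions of ssralg are stated. *)

Section Rings.
Variable R : comNzRingType.
Implicit Types (I J S : set R) (a : R).

(* [comNzRingType] has no decidable unit predicate, so that the theory covers
   every commutative ring with 1 != 0. *)
Definition is_unit a : Prop := exists b, a * b = 1.

Definition ideal I : Prop := submod_closed (mem (I : set R^o)).

Definition maximal_ideal I : Prop :=
  [/\ ideal I, I != setT &
      forall J, ideal J -> J != setT -> I `<=` J -> J = I].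

Definition quasilocal : Prop := exists! I, maximal_ideal I.

(* The exponents are positive; for an ideal this gives the same radical as
   allowing the exponent 0. *)
Definition radical I : set R := [set a | exists n, I (a ^+ n.+1)].

(* [mulr_closed] includes 1 \in S. *)
Definition mult_closed S : Prop := mulr_closed (mem S).

End Rings.

Arguments quasilocal : clear implicits.

Section Modules.
Variables (R : comNzRingType) (M : lmodType R).
Implicit Types (N P : set M) (I S : set R) (m : M).

Definition submodule N : Prop := submod_closed (mem N).

Definition fin_generated : Prop :=
  exists (n : nat) (g : 'I_n -> M),
    forall m, exists a : 'I_n -> R, m = \sum_(i < n) a i *: g i.

(* The submodule I M, consisting of finite sums of products. *)
Definition ideal_mul I : set M :=
  [set m | exists (n : nat) (a : 'I_n -> R) (x : 'I_n -> M),
     (forall i, I (a i)) /\ m = \sum_(i < n) a i *: x i].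

Definition multiplication_module : Prop :=
  forall N, submodule N -> exists2 I, ideal I & N = ideal_mul I.

(* (N :_R M) *)
Definition colon N : set R := [set r | forall m, N (r *: m)].

Definition prime_submodule P : Prop :=
  [/\ submodule P, P != setT &
      forall r m, P (r *: m) -> colon P r \/ P m].

(* The intersection over the empty family is [setT], i.e. M. *)
Definition M_rad N : set M :=
  \bigcap_(P in [set P | prime_submodule P /\ N `<=` P]) P.

Definition S_1_absorbing_primary S N : Prop :=
  [/\ submodule N, colon N `&` S = set0 &
      exists2 s, S s &
        forall a b m, ~ is_unit a -> ~ is_unit b -> N ((a * b) *: m) ->
          colon N (s * a * b) \/ M_rad N (s *: m)].

Definition S_primary S N : Prop :=
  [/\ submodule N, colon N `&` S = set0 &
      exists2 s, S s &
        forall a m, N (a *: m) -> radical (colon N) (s * a) \/ N (s *: m)].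

End Modules.

Arguments fin_generated {R} M.
Arguments multiplication_module {R} M.

(* Main.v *)
Require Import Defs.
From mathcomp Require Import all_boot all_order all_algebra.
From mathcomp Require Import boolp classical_sets.

(** Write [colon (cyclic m)] for the ideal (Rm : M).  In a multiplication
    module m lies in (Rm : M) M, that is, m is a finite sum of c_i y_i with
    c_i M contained in Rm ([mem_colon_cyclic_mul]).  This lets scalars and
    vectors trade places, since a m in N gives c_i (a x) in N for all x in M;
    both implications come from that exchange, and the constant s never
    changes.

    From S-primary to S-1-absorbing primary: if a b m is in N, then
    c_i (a b x) is in N for all x.  Either some s c_i is not in the radical of
    (N : M), and then s a b is in (N : M); or all of them are, and then
    s m = sum of s c_i y_i is in M-rad(N), because each prime submodule that
    contains N absorbs the radical of (N : M) ([radical_colon_sub_M_rad]).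

    From S-1-absorbing primary to S-primary: let a m be in N.  If s a M is
    contained in M-rad(N), then s a is in the radical of (N : M); this is
    the converse of the inclusion above, and the step that uses finite
    generation ([M_rad_colon_sub_radical]).  Otherwise s a x is not in
    M-rad(N) for some x, and c b (a x) in N forces s c b into (N : M) for each
    non-unit c in (Rm : M) and each non-unit b.  If (Rm : M) contains a unit,
    then M = Rm and a itself is in (N : M).  If not, then s b m is in N for
    each non-unit b; a ring that is not quasilocal has two non-units whose sum
    is a unit ([non_quasilocal_unit_sum]), hence s m is in N.

    The inclusion [M_rad_colon_sub_radical] amounts to the existence, for r
    outside the radical of (N : M), of a prime submodule P that contains N
    with r not in (P : M).  Zorn's lemma is applied directly to the submodules
    that contain N and contain no r^n M; finite generation makes them stable
    under unions of chains, and the multiplication property makes a maximal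
    one prime. *)

Set Implicit Arguments.
Unset Strict Implicit.
Unset Printing Implicit Defensive.

Import GRing.Theory.
Local Open Scope classical_set_scope.
Local Open Scope ring_scope.

(** * Chains of sets *)

Section Chains.
Variable T : Type.
Implicit Types (G : set (set T)) (A : set T).

(** [Zorn_bigcup] also asks for the union of the empty chain, which is empty
    and hence never a submodule; it is applied here to the sets A for which
    [A0 `|` A] satisfies P. *)
Lemma Zorn_bigcup_above (P : set (set T)) A0 :
  P A0 ->
  (forall G, G !=set0 -> G `<=` P -> total_on G subset ->
     P (\bigcup_(X in G) X)) ->
  exists A, [/\ P A, A0 `<=` A & forall B, P B -> A `<=` B -> B `<=` A].
Proof.
move=> PA0 Pchain.
have [|A [PA maxA]] := @Zorn_bigcup T [set A | P (A0 `|` A)].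
  move=> F FP Ftot /=.
  pose G : set (set T) := [set A0] `|` [set A0 `|` X | X in F].
  have -> : A0 `|` \bigcup_(X in F) X = \bigcup_(X in G) X.
    apply/seteqP; split=> [x [A0x|[X FX Xx]]|x [_ [->|[X FX <-]]]].
    - by exists A0 => //; left.
    - by exists (A0 `|` X); [right; exists X | right].
    - by left.
    - by case=> [A0x|Xx]; [left | right; exists X].
  apply: Pchain; first by exists A0; left.
    by move=> _ [->//|[X FX <-]]; exact: FP.
  move=> _ _ [->|[X FX <-]] [->|[Y FY <-]].
  - by left.
  - by left; exact: subsetUl.
  - by right; exact: subsetUl.
  - by have [XY|YX] := Ftot X Y FX FY; [left|right]; exact: setUS.
exists (A0 `|` A); split=> // B PB sAB x Bx.
apply: contrapT => nx; apply: (maxA B).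
  split; first by move=> y Ay; apply: sAB; right.
  by move=> BA; apply: nx; right; exact: BA.
rewrite /= (_ : A0 `|` B = B) //.
by apply/setUidPr => y A0y; apply: sAB; left.
Qed.

Lemma chain_bigcup_finite G n (f : 'I_n -> T) :
  G !=set0 -> total_on G subset ->
  (forall i, (\bigcup_(X in G) X) (f i)) ->
  exists2 X, G X & forall i, X (f i).
Proof.
move=> [X0 GX0] Gtot; elim: n f => [|n IHn] f Gf.
  by exists X0 => // -[].
have [X GX Xf] := IHn (fun i => f (lift ord0 i)) (fun i => Gf _).
have [Y GY Yf] := Gf ord0.
have [XY|YX] := Gtot X Y GX GY.
  by exists Y => // i; case: (unliftP ord0 i) => [j|] -> //; exact: XY.
by exists X => // i; case: (unliftP ord0 i) => [j|] ->; [exact: Xf|exact: YX].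
Qed.

End Chains.

(** * Non-units of a ring that is not quasilocal *)

Section NonUnits.
Variable R : comNzRingType.
Implicit Types a b : R.

Lemma is_unitMl a b : is_unit (a * b) -> is_unit b.
Proof. by case=> c abc; exists (a * c); rewrite mulrCA mulrA. Qed.

Lemma idealP (I : set R) :
  ideal I <-> I 0 /\ forall a u v, I u -> I v -> I (a * u + v).
Proof.
split=> [[I0 Il]|[I0 Il]].
  split=> [|a u v Iu Iv]; first by move: I0; rewrite in_setE.
  by have := Il a u v; rewrite !in_setE; apply.
by split=> [|a u v]; rewrite !in_setE //; exact: Il.
Qed.

(** If the sum of two non-units is always a non-unit, then the non-units form
    an ideal; it contains every proper ideal, so it is the only maximal one. *)
Lemma non_quasilocal_unit_sum :
  ~ quasilocal R ->
  exists a b, [/\ ~ is_unit a, ~ is_unit b & is_unit (a + b)].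
Proof.
move=> nql; apply: contrapT => nex; apply: nql.
pose U : set R := [set a | ~ is_unit a].
have U_add a b : U a -> U b -> U (a + b).
  by move=> Ua Ub uab; apply: nex; exists a, b.
have U_ideal : ideal U.
  apply/idealP; split=> [[b]|a u v Uu Uv].
    by rewrite mul0r => /esym/eqP; rewrite oner_eq0.
  by apply: U_add => // /is_unitMl.
have U_proper : U != setT.
  apply/eqP => UT; have : U 1 by rewrite UT.
  by apply; exists 1; rewrite mulr1.
have proper_sub J : ideal J -> J != setT -> J `<=` U.
  move=> /idealP[J0 Jl] /eqP JT a Ja [b ab1]; apply: JT.
  apply/seteqP; split=> // c _.
  by have := Jl (c * b) a 0 Ja J0; rewrite addr0 -mulrA (mulrC b) ab1 mulr1.
exists U; split.
  split=> // J idJ JT UJ.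
  by apply/seteqP; split=> //; exact: proper_sub.
move=> J [idJ JT Jmax]; apply: Jmax => //; exact: proper_sub.
Qed.

End NonUnits.

(** * Submodules and prime submodules *)

Section Modules.
Variables (R : comNzRingType) (M : lmodType R).
Implicit Types (N P K : set M) (a b c r s : R) (m x y : M).

Lemma submoduleP N :
  submodule N <-> N 0 /\ forall a x y, N x -> N y -> N (a *: x + y).
Proof.
split=> [[N0 Nl]|[N0 Nl]].
  split=> [|a u v Nu Nv]; first by move: N0; rewrite in_setE.
  by have := Nl a u v; rewrite !in_setE; apply.
by split=> [|a u v]; rewrite !in_setE //; exact: Nl.
Qed.

Lemma submodule0 N : submodule N -> N 0.
Proof. by case/submoduleP. Qed.

Lemma submoduleD N x y : submodule N -> N x -> N y -> N (x + y).
Proof. by case/submoduleP=> _ Nl Nx Ny; rewrite -[x]scale1r; exact: Nl. Qed.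

Lemma submoduleZ N a x : submodule N -> N x -> N (a *: x).
Proof.
by case/submoduleP=> N0 Nl Nx; rewrite -[_ *: _]addr0; exact: Nl.
Qed.

Lemma submodule_sum N n (f : 'I_n -> M) :
  submodule N -> (forall i, N (f i)) -> N (\sum_(i < n) f i).
Proof.
move=> sN Nf; apply: (big_ind N) => //; first exact: submodule0.
by move=> x y; exact: submoduleD.
Qed.

Lemma submodule_bigcup (G : set (set M)) :
  G !=set0 -> (forall X, G X -> submodule X) -> total_on G subset ->
  submodule (\bigcup_(X in G) X).
Proof.
move=> [X0 GX0] Gsub Gtot; apply/submoduleP; split.
  by exists X0 => //; apply: submodule0; exact: Gsub.
move=> a x y [X GX Xx] [Y GY Yy].
have [XY|YX] := Gtot X Y GX GY.
  exists Y => //; apply: submoduleD => //; first exact: Gsub.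
  by apply: submoduleZ; [exact: Gsub|exact: XY].
exists X => //; apply: submoduleD; [exact: Gsub| |exact: YX].
by apply: submoduleZ => //; exact: Gsub.
Qed.

Definition add_sub N K : set M := [set x + y | x in N & y in K].

Lemma submodule_add N K : submodule N -> submodule K -> submodule (add_sub N K).
Proof.
move=> sN sK; apply/submoduleP; split.
  by exists 0; [exact: submodule0|exists 0; [exact: submodule0|rewrite addr0]].
move=> a _ _ [x Nx [y Ky <-]] [x' Nx' [y' Ky' <-]].
exists (a *: x + x'); first by apply: submoduleD => //; exact: submoduleZ.
exists (a *: y + y'); first by apply: submoduleD => //; exact: submoduleZ.
by rewrite scalerDr addrACA.
Qed.

Lemma add_subl N K : submodule K -> N `<=` add_sub N K.
Proof.
by move=> sK x Nx; exists x => //; exists 0; [exact: submodule0|rewrite addr0].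
Qed.

Lemma add_subr N K : submodule N -> K `<=` add_sub N K.
Proof.
by move=> sN x Kx; exists 0; [exact: submodule0|exists x; rewrite ?add0r].
Qed.

Definition cyclic m : set M := [set a *: m | a in setT].

Lemma submodule_cyclic m : submodule (cyclic m).
Proof.
apply/submoduleP; split; first by exists 0; rewrite ?scale0r.
move=> a _ _ [b _ <-] [c _ <-].
by exists (a * b + c); rewrite ?scalerDl ?scalerA.
Qed.

Definition scaled_module a : set M := range ( *:%R a).

Lemma submodule_scaled_module a : submodule (scaled_module a).
Proof.
apply/submoduleP; split; first by exists 0; rewrite ?scaler0.
move=> b _ _ [x _ <-] [y _ <-]; exists (b *: x + y) => //.
by rewrite scalerDr !scalerA mulrC.
Qed.

(** The ideal that [multiplication_module] provides for Rm consists of scalars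
    that map M into Rm, so it may be enlarged to (Rm : M). *)
Lemma mem_colon_cyclic_mul m :
  multiplication_module M -> ideal_mul (colon (cyclic m)) m.
Proof.
move=> /(_ _ (submodule_cyclic m))[I _ eqI].
have : cyclic m m by exists 1; rewrite ?scale1r.
rewrite {1}eqI => -[n [c [y [Ic mE]]]].
exists n, c, y; split=> // i x; rewrite /colon /= eqI.
exists 1%N, (fun=> c i), (fun=> x); split=> //.
by rewrite big_ord1.
Qed.

(** This is the exchange of scalars and vectors: a c x is a multiple of a m. *)
Lemma colon_cyclic_exchange N a c m x :
  submodule N -> N (a *: m) -> colon (cyclic m) c -> N (c *: (a *: x)).
Proof.
move=> sN Nam /(_ x)[d _ dmE].
rewrite scalerA mulrC -scalerA -dmE scalerA mulrC -scalerA.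
exact: submoduleZ.
Qed.

Lemma prime_colon_exp P r n :
  prime_submodule P -> colon P (r ^+ n.+1) -> colon P r.
Proof.
move=> [_ _ Pprime]; elim: n => [|n IHn]; first by rewrite expr1.
move=> Prn; apply: contrapT => nPr; apply/nPr/IHn => x.
by have := Prn x; rewrite exprS -scalerA => /Pprime[].
Qed.

Lemma submodule_M_rad N : submodule (M_rad N).
Proof.
apply/submoduleP; split=> [P [[sP _ _] _]|a x y Nx Ny P PN].
  exact: submodule0.
have [[sP _ _] _] := PN.
by apply: submoduleD; [|apply: submoduleZ; [|exact: Nx]|exact: Ny].
Qed.

Lemma radical_colon_sub_M_rad N r :
  radical (colon N) r -> colon (M_rad N) r.
Proof.
move=> [n Nrn] x P [Pprime NP]; apply: (@prime_colon_exp P r n) => // y.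
exact/NP/Nrn.
Qed.

(** Suppose a x in K with x not in K and a not in (K : M).  By maximality
    r^i M lies in K + Rx and r^j M lies in K + aM.  With x = sum of c_k y_k
    and c_k M in Rx, each c_k r^j y_k lies in K + a c_k M, which is contained
    in K + R(a x) = K; so r^j x is in K, hence r^(i + j) M lies in K. *)
Lemma maximal_avoiding_prime K r :
  multiplication_module M -> submodule K ->
  ~ radical (colon K) r ->
  (forall L, submodule L -> ~ radical (colon L) r -> K `<=` L -> L `<=` K) ->
  prime_submodule K.
Proof.
move=> hM sK nKr Kmax; split=> //.
  by apply/eqP => KT; apply: nKr; exists 0%N; rewrite KT.
move=> a x Kax; apply: contrapT => /not_orP[nKa nKx].
have [i ri] : radical (colon (add_sub K (cyclic x))) r.
  apply: contrapT => nr; apply: nKx.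
  apply: (Kmax _ _ nr).
  - by apply: submodule_add => //; exact: submodule_cyclic.
  - by apply: add_subl; exact: submodule_cyclic.
  - by apply: add_subr => //; exists 1; rewrite ?scale1r.
have [j rj] : radical (colon (add_sub K (scaled_module a))) r.
  apply: contrapT => nr; apply: nKa => y.
  apply: (Kmax _ _ nr).
  - by apply: submodule_add => //; exact: submodule_scaled_module.
  - by apply: add_subl; exact: submodule_scaled_module.
  - by apply: add_subr => //; exists y.
have Krjx : K (r ^+ j.+1 *: x).
  have [n [c [y [cx xE]]]] := mem_colon_cyclic_mul x hM.
  rewrite xE scaler_sumr; apply: submodule_sum => // k.
  rewrite scalerA mulrC -scalerA.
  have [z Kz [_ [w _ <-] <-]] := rj (y k).
  rewrite scalerDr; apply: submoduleD => //; first exact: submoduleZ.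
  exact: (colon_cyclic_exchange w sK Kax (cx k)).
apply: nKr; exists (j.+1 + i)%N => y.
rewrite -addnS exprD -scalerA.
have [z Kz [_ [d _ <-] <-]] := ri y.
rewrite scalerDr; apply: submoduleD => //; first exact: submoduleZ.
by rewrite scalerA mulrC -scalerA; exact: submoduleZ.
Qed.

(** If r^n M lies in the union of a chain of submodules, then the images under
    r^n of the finitely many generators, hence all of r^n M, lie in a single
    member of the chain. *)
Lemma radical_colon_bigcup (G : set (set M)) r :
  fin_generated M -> G !=set0 -> (forall X, G X -> submodule X) ->
  total_on G subset -> radical (colon (\bigcup_(X in G) X)) r ->
  exists2 X, G X & radical (colon X) r.
Proof.
move=> [k [g gen]] G0 Gsub Gtot [n Grn].
have [X GX Xg] := chain_bigcup_finite G0 Gtot (fun i => Grn (g i)).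
exists X => //; exists n => m; have [a ->] := gen m.
rewrite scaler_sumr; apply: submodule_sum; first exact: Gsub.
move=> i; rewrite scalerA mulrC -scalerA.
by apply: submoduleZ; [exact: Gsub|exact: Xg].
Qed.

Lemma exists_prime_avoiding N r :
  fin_generated M -> multiplication_module M -> submodule N ->
  ~ radical (colon N) r ->
  exists P, [/\ prime_submodule P, N `<=` P & ~ colon P r].
Proof.
move=> hfg hM sN nNr.
pose avoid := [set K : set M | submodule K /\ ~ radical (colon K) r].
have [//||K [[sK nKr] NK Kmax]] := @Zorn_bigcup_above M avoid N.
  move=> G G0 GP Gtot.
  have Gsub X : G X -> submodule X by move=> /GP[].
  split; first exact: submodule_bigcup.
  by move=> /(radical_colon_bigcup hfg G0 Gsub Gtot)[X /GP[_ nXr]].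
exists K; split=> //.
  apply: (@maximal_avoiding_prime K r) => // L sL nLr.
  exact: Kmax.
by move=> Kr; apply: nKr; exists 0%N; rewrite expr1.
Qed.

Lemma M_rad_colon_sub_radical N r :
  fin_generated M -> multiplication_module M -> submodule N ->
  colon (M_rad N) r -> radical (colon N) r.
Proof.
move=> hfg hM sN radr; apply: contrapT.
move=> /(exists_prime_avoiding hfg hM sN)[P [Pprime NP]]; apply => x.
exact: (radr x P).
Qed.

(** * Primary and 1-absorbing primary submodules relative to S *)

Lemma S_primary_S_1_absorbing_primary (S : set R) N :
  multiplication_module M -> S_primary S N -> S_1_absorbing_primary S N.
Proof.
move=> hM [sN NS [s Ss prim]]; split=> //; exists s => // a b m _ _ Nabm.
apply: contrapT => /not_orP[nNsab]; apply.
have [n [c [y [cm ->]]]] := mem_colon_cyclic_mul m hM.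
rewrite scaler_sumr; apply: submodule_sum; first exact: submodule_M_rad.
move=> i; rewrite scalerA; apply: radical_colon_sub_M_rad.
apply: contrapT => nr; apply: nNsab => x.
have /prim[//|] := colon_cyclic_exchange x sN Nabm (cm i).
by rewrite scalerA mulrA.
Qed.

Lemma S_1_absorbing_primary_S_primary (S : set R) N :
  ~ quasilocal R -> fin_generated M -> multiplication_module M ->
  S_1_absorbing_primary S N -> S_primary S N.
Proof.
move=> hR hfg hM [sN NS [s Ss absorb]]; split=> //; exists s => // a m Nam.
have [sarad|nsarad] := pselect (colon (M_rad N) (s * a)).
  by left; exact: M_rad_colon_sub_radical.
have [x nx] : exists x, ~ M_rad N ((s * a) *: x).
  apply: contrapT => nex; apply: nsarad => x.
  by apply: contrapT => nx; apply: nex; exists x.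
have [[c [cm [d cd1]]]|no_unit] :=
    pselect (exists c, colon (cyclic m) c /\ is_unit c).
  left; exists 0%N => y; rewrite expr1 -scalerA; apply: submoduleZ => //.
  have := colon_cyclic_exchange (d *: y) sN Nam cm.
  by rewrite !scalerA mulrAC cd1 mul1r.
right.
have Nscb c b : colon (cyclic m) c -> ~ is_unit b -> colon N (s * c * b).
  move=> cm nub.
  have nuc : ~ is_unit c by move=> uc; apply: no_unit; exists c.
  have Ncbax : N ((c * b) *: (a *: x)).
    rewrite mulrC -scalerA; apply: submoduleZ => //.
    exact: colon_cyclic_exchange Nam cm.
  by have [//|] := absorb c b (a *: x) nuc nub Ncbax; rewrite scalerA.
have Nsbm b : ~ is_unit b -> N (b *: (s *: m)).
  move=> nub; have [n [c [y [cm ->]]]] := mem_colon_cyclic_mul m hM.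
  rewrite scalerA scaler_sumr; apply: submodule_sum => // i.
  by rewrite scalerA -mulrA mulrC; exact: Nscb.
have [b [b' [nub nub' [d bb'd]]]] := non_quasilocal_unit_sum hR.
rewrite -[s *: m]scale1r -bb'd mulrC -scalerA scalerDl.
by apply: submoduleZ => //; apply: submoduleD => //; exact: Nsbm.
Qed.

End Modules.

Theorem theorem6 (R : comNzRingType) (S : set R) (M : lmodType R) (N : set M)
  (hR : ~ quasilocal R)
  (hS : mult_closed S)
  (hfg : fin_generated M)
  (hM : multiplication_module M)
  (hN : submodule N)
  (hNS : colon N `&` S = set0) :
  S_1_absorbing_primary S N <-> S_primary S N.
Proof.
split; first exact: S_1_absorbing_primary_S_primary.
exact: S_primary_S_1_absorbing_primary.
Qed.
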